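(* Assume that (A1) holds. Let $(t_0,x_0)\in\Omega$ be such that $\ell(t_0,x_0)$ is a singleton. Then the function $u(t,x)=\max_{q\in\mathbb R^n}\{\langle x,q\rangle-\sigma^*(q)-\int_0^tH(\tau,q)\,d\tau\}$ is differentiable at $(t_0,x_0)$.
   Context: Let $T>0$ and $\Omega=(0,T)\times\mathbb R^n$; $|\cdot|$ and $\langle\cdot,\cdot\rangle$ are the Euclidean norm and scalar product. Let $H=H(t,p)\in C([0,T]\times\mathbb R^n)$ be real-valued and let $\sigma:\mathbb R^n\to\mathbb R$ be continuous and convex. $\sigma^*:\mathbb R^n\to\mathbb R\cup\{+\infty\}$ denotes the Fenchel conjugate of $\sigma$. Condition (A1): for every $(t_0,x_0)\in[0,T)\times\mathbb R^n$ there exist positive constants $r$ and $N$ such that $$\langle x,p\rangle-\sigma^*(p)-\int_0^tH(\tau,p)\,d\tau<\max_{|q|\le N}\Big\{\langle x,q\rangle-\sigma^*(q)-\int_0^tH(\tau,q)\,d\tau\Big\}$$ whenever $(t,x)\in[0,T)\times\mathbb R^n$, $|t-t_0|+|x-x_0|<r$ and $|p|>N$. Put $\varphi(t,x,q)=\langle x,q\rangle-\sigma^*(q)-\int_0^tH(\tau,q)\,d\tau$. For $(t,x)\in\Omega$, $\ell(t,x)$ is the set of all $p\in\mathbb R^n$ at which the maximum over $\mathbb R^n$ of $\varphi(t,x,\cdot)$ is attained; under (A1) it is nonempty. Differentiability is with respect to $(t,x)$ jointly. *)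

(* Defs.v *)
From HB Require Import structures.
From mathcomp Require Import all_boot all_order all_algebra.
From mathcomp Require Import all_classical all_reals all_analysis.

Set Implicit Arguments.
Unset Strict Implicit.
Unset Printing Implicit Defensive.

Import Order.TTheory GRing.Theory Num.Theory.
Import numFieldNormedType.Exports.

Local Open Scope classical_set_scope.
Local Open Scope ring_scope.

(* The library norm on ['rV[R]_n] is the sup norm, hence [enorm]. *)
Definition dot (R : realType) (n : nat) (x y : 'rV[R]_n) : R :=
  \sum_(i < n) x 0 i * y 0 i.

Definition enorm (R : realType) (n : nat) (x : 'rV[R]_n) : R :=
  Num.sqrt (dot x x).

Definition fenchel (R : realType) (n : nat) (sigma : 'rV[R]_n -> R)
    (p : 'rV[R]_n) : \bar R :=
  ereal_sup (range (fun x => (dot x p - sigma x)%:E)).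

(* Greatest element of [A]: unlike [ereal_sup], it has to belong to [A].
   The junk value when there is none is [-oo], so that [a < emax A] fails. *)
Definition emax (R : realType) (A : set (\bar R)) : \bar R :=
  xget -oo%E (A `&` ubound A).

Lemma emaxE (R : realType) (A : set (\bar R)) (m : \bar R) :
  A m -> ubound A m -> emax A = m.
Proof.
move=> Am ubm; apply: xget_unique => [//|y [Ay uby]].
by apply/eqP; rewrite eq_le ubm ?uby.
Qed.

Section hopf_formula.
Variables (R : realType) (n : nat).
Variables (T : R) (H : R * 'rV[R]_n -> R) (sigma : 'rV[R]_n -> R).

Definition phi (t : R) (x q : 'rV[R]_n) : \bar R :=
  ((dot x q)%:E - fenchel sigma q
   - (\int[lebesgue_measure]_(tau in `[0, t]) H (tau, q))%:E)%E.

Definition condA1 : Prop :=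
  forall (t0 : R) (x0 : 'rV[R]_n), 0 <= t0 < T ->
    exists r N : R, [/\ 0 < r, 0 < N &
      forall (t : R) (x p : 'rV[R]_n), 0 <= t < T ->
        `|t - t0| + enorm (x - x0) < r -> N < enorm p ->
        (phi t x p < emax (phi t x @` [set q | (enorm q <= N)%R]))%E].

Definition ell (t : R) (x : 'rV[R]_n) : set 'rV[R]_n :=
  [set p | forall q, (phi t x q <= phi t x p)%E].

(* [fine] is harmless on (0, T) x R^n: under [condA1] the maximum is attained
   there, and it is finite because [fenchel sigma] is proper. *)
Definition hopf (z : R * 'rV[R]_n) : R := fine (emax (range (phi z.1 z.2))).

End hopf_formula.

(* Main.v *)
Require Import Defs.
From HB Require Import structures.
From mathcomp Require Import all_boot all_order all_algebra.
From mathcomp Require Import all_classical all_reals all_analysis.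
From mathcomp Require Import ring lra.

Import Order.TTheory GRing.Theory Num.Theory.
Import numFieldNormedType.Exports.

Local Open Scope classical_set_scope.
Local Open Scope ring_scope.

(* Let [p0] be the only maximizer at [(t0, x0)] and [G t q] the time integral of
   [H].  By (A1) maximizers at nearby points [(t, x)] exist and stay in a fixed
   compact set; [fenchel sigma] being a supremum of continuous functions,
   [phi t x q < phi t x p0] is an open condition, so a compactness argument
   forces these maximizers to tend to [p0].  Comparing [hopf] at [(t, x)] and
   [(t0, x0)] through [p0] from below and through a maximizer [p] at [(t, x)]
   from above, the [fenchel sigma] terms cancel, and the two bounds differ from
   [dot (x - x0) p0 - H (t0, p0) * (t - t0)] by [o(|t - t0| + |x - x0|)]. *)

(** * Scalar product, and comparison of the Euclidean norm with the sup norm *)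

Section euclidean.
Context {R : realType} {n : nat}.
Implicit Types x y : 'rV[R]_n.

Lemma dotDl x y z : dot (x + y) z = dot x z + dot y z.
Proof. by rewrite -big_split; apply: eq_bigr => i _; rewrite mxE mulrDl. Qed.

Lemma dotZl (a : R) x y : dot (a *: x) y = a * dot x y.
Proof. by rewrite mulr_sumr; apply: eq_bigr => i _; rewrite mxE mulrA. Qed.

Lemma dotC x y : dot x y = dot y x.
Proof. by apply: eq_bigr => i _; rewrite mulrC. Qed.

Lemma dotBl x y z : dot (x - y) z = dot x z - dot y z.
Proof. by rewrite dotDl -scaleN1r dotZl mulN1r. Qed.

Lemma dotBr x y z : dot z (x - y) = dot z x - dot z y.
Proof. by rewrite !(dotC z) dotBl. Qed.

Lemma dot_ge0 x : 0 <= dot x x.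
Proof. by apply: sumr_ge0 => i _; rewrite -expr2 sqr_ge0. Qed.

Lemma le_coord_norm x i : `|x 0 i| <= `|x|.
Proof.
rewrite [leRHS]/Num.norm /= mx_normrE.
by apply/bigmax_geP; right; exists (0, i).
Qed.

Lemma le_coord_enorm x i : `|x 0 i| <= enorm x.
Proof.
rewrite -sqrtr_sqr ler_sqrt ?dot_ge0// /dot (bigD1 i)//= expr2 lerDl.
by apply: sumr_ge0 => j _; rewrite -expr2 sqr_ge0.
Qed.

Lemma le_norm_enorm x : `|x| <= enorm x.
Proof.
rewrite [leLHS]/Num.norm /= mx_normrE; apply/bigmax_leP; split.
  exact: sqrtr_ge0.
by move=> [i j] _ /=; rewrite ord1; exact: le_coord_enorm.
Qed.

(** Bounding each coordinate product separately costs a factor [n], but keeps the estimate in the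
    sup norm, the one in which differentiability is expressed. *)
Lemma norm_dot_le x y : `|dot x y| <= n%:R * (`|x| * `|y|).
Proof.
apply: (le_trans (ler_norm_sum _ _ _)).
apply: (@le_trans _ _ (\sum_(i < n) (`|x| * `|y|))).
  by apply: ler_sum => i _; rewrite normrM ler_pM// le_coord_norm.
by rewrite sumr_const card_ord mulr_natl.
Qed.

Lemma cvg_dot (S : Type) (F : set_system S) {FF : Filter F}
    (f g : S -> 'rV[R]_n) (a b : 'rV[R]_n) :
  f @ F --> a -> g @ F --> b -> dot (f s) (g s) @[s --> F] --> dot a b.
Proof.
move=> fa gb; apply: (@cvg_big R^o) => [|i _]; first exact: add_continuous.
have coord (h : S -> 'rV[R]_n) (c : 'rV[R]_n) :
    h @ F --> c -> h s 0 i @[s --> F] --> c 0 i.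
  move=> hc; apply: (cvg_comp h (fun u : 'rV[R]_n => u 0 i) hc).
  exact: coord_continuous.
by apply: cvgM; exact: coord.
Qed.

Lemma continuous_enorm : continuous (@enorm R n).
Proof.
move=> x; apply: (cvg_comp (fun y : 'rV[R]_n => dot y y) Num.sqrt).
  exact: (@cvg_dot _ (nbhs x) (nbhs_filter x) id id x x).
exact: sqrt_continuous.
Qed.

End euclidean.

(** * Differentiability criterion, neighbourhoods in a product, increments of integrals *)

Lemma near_differentiable {R : realType} {V W : normedModType R} (f : V -> W)
    (df : {linear V -> W}) (x : V) : continuous df ->
  (forall e, 0 < e ->
    \forall y \near x, `|f y - f x - df (y - x)| <= e * `|y - x|) ->
  differentiable f x.
Proof.
move=> cdf near_f.
(* This is the hypothesis moved to the origin; uniqueness of the first-order expansion then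
   identifies [df] with the differential. *)
have fE : f \o shift x = cst (f x) + df +o_ 0 id.
  apply/eqaddoP => e e0; rewrite near_simpl.
  have := near_f _ e0; rewrite (near_shift 0 x) /= => near0.
  near=> h; have : `|f (h + (x - 0)) - f x - df (h + (x - 0) - x)|
                   <= e * `|h + (x - 0) - x| by near: h.
  by rewrite subr0 addrK opprD addrA.
by apply/diff_locallyP; rewrite (diff_unique cdf fE).
Unshelve. all: by end_near. Qed.

Lemma near_fst {U V : topologicalType} (x : U) (y : V) (P : U -> Prop) :
  (\forall t \near x, P t) -> \forall z \near (x, y), P z.1.
Proof.
by move=> Px; exists (P, setT); [split=> //; exact: filterT|case=> u v []].
Qed.

Lemma near_snd {U V : topologicalType} (x : U) (y : V) (P : V -> Prop) :
  (\forall t \near y, P t) -> \forall z \near (x, y), P z.2.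
Proof.
by move=> Py; exists (setT, P); [split=> //; exact: filterT|case=> u v []].
Qed.

(** The left-hand side is the norm of the integral of [f - c] over []s, t]], where the integrand is
    at most [e] in norm. *)
Lemma Rintegral_increment_le {R : realType} (f : R -> R) (a s t c e : R) :
  lebesgue_measure.-integrable `[a, t] (EFin \o f) -> a <= s -> s <= t ->
  (forall tau, s <= tau <= t -> `|f tau - c| <= e) ->
  `|\int[lebesgue_measure]_(tau in `[a, t]) f tau
    - \int[lebesgue_measure]_(tau in `[a, s]) f tau - c * (t - s)|
    <= e * (t - s).
Proof.
move=> intf as_ st near_c.
have measE : fine (lebesgue_measure (`]s, t] : set R)) = t - s.
  rewrite lebesgue_measure_itv /= lte_fin; case: ltP => //= ts.
  by apply/esym/eqP; rewrite subr_eq0 eq_le st ts.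
have mst : measurable (`]s, t] : set (measurableTypeR R)).
  exact: measurable_itv.
have intst : lebesgue_measure.-integrable `]s, t] (EFin \o f).
  apply: integrableS intf => //; apply: subset_itvr; by rewrite bnd_simp.
have intcst (k : R) :
    lebesgue_measure.-integrable (`]s, t] : set R) (EFin \o cst k).
  apply: (@integrableS _ _ _ lebesgue_measure `[s, t]) => //.
    exact: subset_itv_oc_cc.
  apply: continuous_compact_integrable; first exact: segment_compact.
  by apply: continuous_subspaceT => x; exact: cvg_cst.
have intB :
    lebesgue_measure.-integrable `]s, t] (EFin \o (fun tau => f tau - c)).
  by have := integrableB mst intst (intcst c).
rewrite Rintegral_itvB// -{1}measE -Rintegral_cst// -RintegralB//; last first.
  exact: intcst c.
apply: (le_trans (le_normr_Rintegral _ _)) => //.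
rewrite -measE -Rintegral_cst//; apply: le_Rintegral => //.
- exact: integrable_norm intB.
- exact: intcst e.
move=> tau /=; rewrite in_itv/= => /andP[/ltW h1 h2].
by apply: near_c; rewrite h1.
Qed.

Lemma near_dist_lt {R : realType} {V : normedModType R} (x : V) (e : R) :
  0 < e -> \forall y \near x, `|y - x| < e.
Proof.
move=> e0; near=> y; rewrite distrC; suff : ball x e y by rewrite -ball_normE.
by near: y; exact: nbhsx_ballx.
Unshelve. all: by end_near. Qed.

Lemma near_enorm_lt {R : realType} {n : nat} (x : 'rV[R]_n) (e : R) :
  0 < e -> \forall y \near x, enorm (y - x) < e.
Proof.
move=> e0; apply: (@cvgr_lt _ _ _ (nbhs_filter x) _ (enorm (x - x))).
  apply: (cvg_comp (fun y : 'rV[R]_n => y - x) (@enorm R n)).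
    by apply: cvgB; [exact: cvg_id|exact: cvg_cst].
  exact: continuous_enorm.
rewrite subrr /enorm /dot big1 ?sqrtr0// => i _.
by rewrite mxE mul0r.
Qed.

(** * Regularity of the time integral of the Hamiltonian *)

Section hamiltonian.
Context {R : realType} {n : nat}.
Variables (T : R) (H : R * 'rV[R]_n -> R).
Hypothesis H_cont : {within `[0, T]%classic `*` [set: 'rV[R]_n], continuous H}.

Let G t q := \int[lebesgue_measure]_(tau in `[0, t]) H (tau, q).

(** Trades continuity within the strip for full neighbourhoods with a guard on the time, which
    combine freely with other [near] statements. *)
Lemma near_hamiltonian (tau : R) (q : 'rV[R]_n) (e : R) :
  0 <= tau <= T -> 0 < e ->
  \forall z \near (tau, q), 0 <= z.1 <= T -> `|H z - H (tau, q)| <= e.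
Proof.
move=> tauT e0.
move/subspace_continuousP : H_cont => /(_ (tau, q)).
rewrite /= in_itv/= => /(_ (conj tauT I)) /cvgrPdist_le /(_ _ e0).
rewrite near_withinE; apply: filterS => z Hz z1T.
by rewrite distrC; apply: Hz => /=; split => //; rewrite in_itv.
Qed.

Lemma hamiltonian_integrable (q : 'rV[R]_n) (t : R) : t <= T ->
  lebesgue_measure.-integrable `[0, t] (EFin \o (fun tau => H (tau, q))).
Proof.
move=> tT; apply: continuous_compact_integrable; first exact: segment_compact.
apply/subspace_continuousP => tau /=; rewrite in_itv/= => /andP[tau0 taut].
apply/cvgrPdist_le => e e0; rewrite near_withinE.
have tauT : 0 <= tau <= T by rewrite tau0 (le_trans taut).
have /= := near_hamiltonian tau q e tauT e0.
have cvgq : (fun s : R => (s, q)) @ tau --> (tau, q).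
  exact: (cvg_pair cvg_id (cvg_cst q)).
move/cvgq => near_s; near=> s.
have Hs : 0 <= s <= T -> `|H (s, q) - H (tau, q)| <= e by near: s.
rewrite in_itv/= => /andP[s0 st].
by rewrite distrC Hs//= s0 (le_trans st).
Unshelve. all: by end_near. Qed.

(* Uniformity in [z.2] lets the momentum be a maximizer varying with [z.1]. *)
Lemma near_action_increment (t0 : R) (p0 : 'rV[R]_n) (e : R) :
  0 < t0 < T -> 0 < e ->
  \forall z \near (t0, p0),
    `|G z.1 z.2 - G t0 z.2 - H (t0, p0) * (z.1 - t0)| <= e * `|z.1 - t0|.
Proof.
move=> /andP[t00 t0T] e0.
have t0T' : 0 <= t0 <= T by rewrite !ltW.
have /nbhs_ballP[r /= r0 Hr] := near_hamiltonian t0 p0 e t0T' e0.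
near=> z.
have /andP[z0 zT] : 0 < z.1 < T.
  suff : z.1 \in `]0, T[ by rewrite in_itv.
  near: z; apply: (@near_fst R _ t0 p0 (fun t => t \in `]0, T[)).
  by apply: near_in_itvoo; rewrite in_itv/= t00.
have [bz1 bz2] : ball (t0, p0) r z by near: z; exact: nbhsx_ballx.
have Hbound tau : 0 <= tau <= T -> `|tau - t0| <= `|z.1 - t0| ->
    `|H (tau, z.2) - H (t0, p0)| <= e.
  move=> tauT tauz; apply: Hr => //; split=> //=.
  move: bz1; rewrite /ball /= => bz1.
  by rewrite distrC (le_lt_trans tauz)// distrC.
have [t0z|/ltW zt0] := leP t0 z.1.
  rewrite [in leRHS]ger0_norm ?subr_ge0//.
  apply: Rintegral_increment_le => //; [|exact: ltW|].
    exact/hamiltonian_integrable/ltW.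
  move=> tau /andP[t0tau tauz]; apply: Hbound.
    by rewrite (le_trans _ t0tau)/= ?(le_trans tauz)// ltW.
  by rewrite !ger0_norm ?subr_ge0// lerD2r.
(* For [z.1 <= t0] the signs are reversed, which turns the claim into the increment estimate on
   []z.1, t0]]. *)
rewrite -normrN [X in e * X]distrC [X in e * X]ger0_norm ?subr_ge0//.
rewrite -mulrN opprB !opprD !opprK.
rewrite [- G _ _ + _]addrC.
apply: Rintegral_increment_le => //; [|exact: ltW|].
  exact/hamiltonian_integrable/ltW.
move=> tau /andP[ztau taut0]; apply: Hbound.
  by rewrite (le_trans _ ztau)/= ?(le_trans taut0)// ltW.
by rewrite !ler0_norm ?subr_le0// lerN2 lerD2r.
Unshelve. all: by end_near. Qed.

(** By compactness of [[0, t]], [H (tau, q)] tends to [H (tau, p0)] uniformly in [tau], and the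
    uniform bound is integrated. *)
Lemma cvg_action_momentum (t : R) (p0 : 'rV[R]_n) : 0 <= t <= T ->
  G t q @[q --> p0] --> G t p0.
Proof.
move=> /andP[t0 tT]; apply/(@cvgrPdist_le _ _ _ _ (nbhs_filter p0)) => e e0.
(* Dividing by [t + 1] instead of [t] includes the case [t = 0]. *)
have t10 : 0 < t + 1 by rewrite ltr_wpDl.
have e'0 : 0 < e / (t + 1) / 2 by rewrite !divr_gt0.
have /compact_near_coveringP/near_covering_withinP cover :=
  @segment_compact R 0 t.
have : \forall q \near p0, `[0, t] `<=`
    [set tau | `|H (tau, q) - H (tau, p0)| <= e / (t + 1)].
  apply: (cover _ (nbhs p0) (fun q tau => `|H (tau, q) - H (tau, p0)| <= _)
    (nbhs_filter p0)) => tau /=; rewrite in_itv/= => /andP[tau0 taut].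
  have tauT : 0 <= tau <= T by rewrite tau0 (le_trans taut).
  have near_H := near_hamiltonian tau p0 _ tauT e'0.
  have near_Hp0 : \forall s \near tau, 0 <= s <= T ->
      `|H (s, p0) - H (tau, p0)| <= e / (t + 1) / 2.
    apply: (cvg_pair cvg_id (@cvg_cst _ p0 _ (nbhs tau) _)) near_H.
  near=> z => /=; rewrite in_itv/= => /andP[z0 zt].
  have zT : 0 <= z.1 <= T by rewrite z0 (le_trans zt).
  (* Both [H z] and [H (z.1, p0)] are compared with [H (tau, p0)], each within half of the
     tolerance. *)
  rewrite [leRHS]splitr -(subrKA (H (tau, p0))) (le_trans (ler_normD _ _))//.
  apply: lerD.
    rewrite -surjective_pairing.
    suff : 0 <= z.1 <= T -> `|H z - H (tau, p0)| <= e / (t + 1) / 2 by apply.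
    by near: z.
  suff : 0 <= z.1 <= T -> `|H (z.1, p0) - H (tau, p0)| <= e / (t + 1) / 2.
    by rewrite distrC; apply.
  near: z; exact: (near_fst _ _ _ near_Hp0).
move=> near_q; near=> q.
have Hq : `[0, t] `<=` [set tau | `|H (tau, q) - H (tau, p0)| <= e / (t + 1)].
  by near: q.
have intH p := hamiltonian_integrable p _ tT.
have mt : measurable (`[0, t] : set (measurableTypeR R)).
  exact: measurable_itv.
have := @Rintegral_increment_le _ (fun tau => H (tau, q) - H (tau, p0))
  0 0 t 0 (e / (t + 1)) (integrableB mt (intH q) (intH p0)) (lexx 0) t0.
rewrite set_itv1 Rintegral_set1 mul0r !subr0 RintegralB// distrC => intB.
apply: le_trans (intB _) _ => [tau tauT|].
  by rewrite subr0; apply: Hq; rewrite /= in_itv.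
by rewrite mulrAC ler_pdivrMr// ler_pM2l// lerDl.
Unshelve. all: by end_near. Qed.

Lemma cvg_action (t0 : R) (p0 : 'rV[R]_n) : 0 < t0 < T ->
  G z.1 z.2 @[z --> (t0, p0)] --> G t0 p0.
Proof.
move=> t0T; apply/cvgrPdist_le => e e0.
have t0T' : 0 <= t0 <= T by case/andP: t0T => *; rewrite !ltW.
have e20 : 0 < e / 2 by rewrite divr_gt0.
have near_q : \forall q \near p0, `|G t0 p0 - G t0 q| <= e / 2.
  have cvgGq := cvg_action_momentum t0 p0 t0T'.
  exact: ((@cvgrPdist_le _ _ _ _ (nbhs_filter p0) _ _).1 cvgGq).
(* Near [(t0, p0)] this is a Lipschitz constant in time for [G] about [t0]: the slope plus the error
   of the increment estimate taken with [e = 1]. *)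
have c0 : 0 < `|H (t0, p0)| + 1 by rewrite ltr_wpDl.
have near_t : \forall t \near t0, `|t0 - t| <= e / 2 / (`|H (t0, p0)| + 1).
  apply: ((@cvgrPdist_le _ _ _ _ (nbhs_filter t0) id t0).1 cvg_id).
  by rewrite !divr_gt0.
near=> z.
have incr :
    `|G z.1 z.2 - G t0 z.2 - H (t0, p0) * (z.1 - t0)| <= 1 * `|z.1 - t0|.
  by near: z; exact: near_action_increment.
have Gq : `|G t0 p0 - G t0 z.2| <= e / 2.
  by near: z; exact: (near_snd _ _ _ near_q).
have zt : `|t0 - z.1| <= e / 2 / (`|H (t0, p0)| + 1).
  by near: z; exact: (near_fst _ _ _ near_t).
move: zt; rewrite ler_pdivlMr// mulrDr mulr1 distrC -normrM => zt.
rewrite mul1r in incr; rewrite mulrC in zt.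
have : - `|H (t0, p0) * (z.1 - t0)| <= H (t0, p0) * (z.1 - t0)
       <= `|H (t0, p0) * (z.1 - t0)| by rewrite -ler_norml.
move: incr Gq zt; rewrite !ler_norml; lra.
Unshelve. all: by end_near. Qed.

End hamiltonian.

(** * Existence and localization of the maximizers near [(t0, x0)] *)

Section maximizers.
Context {R : realType} {n : nat}.
Variables (T : R) (H : R * 'rV[R]_n -> R) (sigma : 'rV[R]_n -> R).
Hypothesis H_cont : {within `[0, T]%classic `*` [set: 'rV[R]_n], continuous H}.
Hypothesis hA1 : condA1 T H sigma.
Variables (t0 : R) (x0 p0 : 'rV[R]_n).
Hypothesis t0T : 0 < t0 < T.
Hypothesis ell_p0 : ell H sigma t0 x0 = [set p0].

Let G t q := \int[lebesgue_measure]_(tau in `[0, t]) H (tau, q).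
Let phi := phi H sigma.
Let ell := ell H sigma.

Lemma fenchel_ge (y q : 'rV[R]_n) :
  ((dot y q - sigma y)%:E <= fenchel sigma q)%E.
Proof. by apply: ereal_sup_ubound; exists y. Qed.

Lemma phi_fin t x q s : fenchel sigma q = s%:E ->
  phi t x q = (dot x q - s - G t q)%:E.
Proof. by rewrite /phi /Defs.phi => ->. Qed.

Lemma phi_pinfty t x q : fenchel sigma q = +oo%E -> phi t x q = -oo%E.
Proof. by rewrite /phi /Defs.phi => ->. Qed.

(** The value [-oo] is excluded by the lower bound [- sigma 0]. *)
Lemma fenchel_cases q :
  fenchel sigma q = +oo%E \/ exists s, fenchel sigma q = s%:E.
Proof.
case E : (fenchel sigma q) => [s||]; [by right; exists s|by left|].
by have := fenchel_ge 0 q; rewrite E leeNy_eq.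
Qed.

Lemma ell_t0 q : (phi t0 x0 q <= phi t0 x0 p0)%E.
Proof. by have : ell t0 x0 p0 by rewrite /ell ell_p0. Qed.

(* If the conjugate were infinite at [p0], every vector would be a maximizer,
   so [p0] would be the only vector, and a supremum over one point is finite. *)
Lemma fenchel_p0 : exists s, fenchel sigma p0 = s%:E.
Proof.
case: (fenchel_cases p0) => // p0oo.
have all_p0 q : q = p0.
  have : ell t0 x0 q.
    by move=> q'; rewrite (le_trans (ell_t0 _))// phi_pinfty// leNye.
  by rewrite /ell ell_p0.
have : (fenchel sigma p0 <= (dot p0 p0 - sigma p0)%:E)%E.
  by apply: ge_ereal_sup => _ [y _ <-]; rewrite (all_p0 y).
by rewrite p0oo leye_eq.
Qed.

(** The strict inequality of (A1) acts twice: as [emax] defaults to [-oo], it forces the maximum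
    over the ball of radius [N] to be attained, and it puts every vector outside the ball below that
    maximum. *)
Lemma near_ell_attained : exists N : R, \forall z \near (t0, x0),
  exists2 p, enorm p <= N & ell z.1 z.2 p.
Proof.
have [t00 t0T'] := andP t0T.
have [|r [N [r0 N0 far]]] := hA1 t0 x0; first by rewrite ltW.
have r20 : 0 < r / 2 by rewrite divr_gt0.
exists N; near=> z.
have zT : 0 <= z.1 < T.
  have : z.1 \in `]0, T[; last by rewrite in_itv/= => /andP[/ltW-> ->].
  near: z; apply: (@near_fst R _ t0 x0 (fun t => t \in `]0, T[)).
  by apply: near_in_itvoo; rewrite in_itv/= t00.
have zr : `|z.1 - t0| + enorm (z.2 - x0) < r.
  rewrite (splitr r) ltrD//; near: z.
    apply: (@near_fst R _ t0 x0 (fun t => `|t - t0| < r / 2)).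
    exact: (@near_dist_lt R R^o).
  apply: (@near_snd _ _ t0 x0 (fun x => enorm (x - x0) < r / 2)).
  exact: near_enorm_lt.
(* If no vector lies outside the ball, (A1) is vacuous; but scaling a nonzero vector would produce
   one, so the space is reduced to [0] and [p0] is a maximizer. *)
have [[q Nq]|allN] := pselect (exists q : 'rV[R]_n, N < enorm q).
  have := far z.1 z.2 q zT zr Nq; rewrite /emax.
  case: xgetP => [m _ [[p pN pm] ub] _|_]; last by rewrite ltNge leNye.
  exists p => // q'; rewrite -/(phi _ _ _) pm.
  have [q'N|Nq'] := leP (enorm q') N; first by apply: ub; exists q'.
  have := far z.1 z.2 q' zT zr Nq'.
  by rewrite (@emaxE _ _ m)//; [exact: ltW|exists p].
have all0 (q : 'rV[R]_n) : q = 0.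
  apply/eqP/negPn/negP; rewrite -normr_gt0 => q0; apply: allN.
  exists (((N + 1) / `|q|) *: q); apply: lt_le_trans (le_norm_enorm _).
  rewrite normrZ normrM normfV normr_id divfK ?gt_eqF//.
  by rewrite ger0_norm ?ltrDl ?addr_ge0// ltW.
exists p0; first by rewrite leNgt; apply/negP => p0N; apply: allN; exists p0.
by move=> q; rewrite (all0 q) (all0 p0).
Unshelve. all: by end_near. Qed.

Lemma near_phi_lt q : q <> p0 ->
  \forall q' \near q & z \near (t0, x0),
    (phi z.1 z.2 q' < phi z.1 z.2 p0)%E.
Proof.
move=> qp0; have [s p0s] := fenchel_p0.
have lt0 : (phi t0 x0 q < phi t0 x0 p0)%E.
  rewrite ltNge; apply/negP => le0; apply: qp0.
  suff : ell t0 x0 q by rewrite /ell ell_p0.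
  by move=> q'; apply: le_trans le0; exact: ell_t0.
(* [f (q', z)] is the threshold for the conjugate: [phi] at [z] is smaller at [q'] than at [p0]
   exactly when [fenchel sigma q'] exceeds it. *)
pose f (w : 'rV[R]_n * (R * 'rV[R]_n)) : R := dot w.2.2 w.1 - G w.2.1 w.1
  - (dot w.2.2 p0 - s - G w.2.1 p0).
have [y fy] : exists y, f (q, (t0, x0)) < dot y q - sigma y.
  have : ((f (q, (t0, x0)))%:E < fenchel sigma q)%E.
    move: lt0; rewrite (phi_fin _ _ _ _ p0s).
    case: (fenchel_cases q) => [->|[k qk]]; first by rewrite ltry.
    by rewrite qk (phi_fin _ _ _ _ qk) !lte_fin /f /=; lra.
  by case/ereal_sup_gt => _ [y _ <-]; rewrite lte_fin => fy; exists y.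
have cvg_f : f w @[w --> (q, (t0, x0))] --> f (q, (t0, x0)).
  pose V := ('rV[R]_n * (R * 'rV[R]_n))%type; pose W : V := (q, (t0, x0)).
  have FW : Filter (nbhs W) := nbhs_filter W.
  have cvgq : w.1 @[w --> W] --> q by exact: cvg_fst.
  have cvgz : w.2 @[w --> W] --> (t0, x0) by exact: cvg_snd.
  have cvgt : w.2.1 @[w --> W] --> t0.
    exact: (cvg_comp (fun w : V => w.2) fst cvgz cvg_fst).
  have cvgx : w.2.2 @[w --> W] --> x0.
    exact: (cvg_comp (fun w : V => w.2) snd cvgz cvg_snd).
  have cvgG (g : V -> 'rV[R]_n) (b : 'rV[R]_n) :
      g @ W --> b -> G w.2.1 (g w) @[w --> W] --> G t0 b.
    move=> gb; apply: (cvg_comp (fun w => (w.2.1, g w)) (fun z => G z.1 z.2)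
      (cvg_pair cvgt gb)).
    exact: cvg_action.
  apply: cvgB; apply: cvgB;
    [exact: cvg_dot|exact: cvgG| |apply: cvgG; exact: cvg_cst].
  by apply: cvgB; [apply: cvg_dot => //; exact: cvg_cst|exact: cvg_cst].
have near_f : \forall w \near (q, (t0, x0)), 0 < dot y w.1 - sigma y - f w.
  have FW := nbhs_filter (q, (t0, x0)).
  apply: (@cvgr_gt _ _ _ FW _
    (dot y q - sigma y - f (q, (t0, x0)))); last by rewrite subr_gt0.
  apply: cvgB => //; apply: cvgB; last exact: cvg_cst.
  by apply: cvg_dot; [exact: cvg_cst|exact: cvg_fst].
apply: filterS near_f => -[q' z] /=.
rewrite (phi_fin _ _ _ _ p0s) => fw.
case: (fenchel_cases q') => [q'oo|[k q'k]]; first by rewrite phi_pinfty// ltNyr.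
have := fenchel_ge y q'; rewrite q'k lee_fin => yk.
by rewrite (phi_fin _ _ _ _ q'k) lte_fin; move: fw yk; rewrite /f /=; lra.
Qed.

(** Away from [p0], the bounded momenta form a compact set. The local strict inequalities hold on
    all of it for a common neighbourhood of [(t0, x0)], so it contains no maximizer. *)
Lemma near_ell_close (N e : R) : 0 < e ->
  \forall z \near (t0, x0),
    forall p, enorm p <= N -> ell z.1 z.2 p -> `|p - p0| < e.
Proof.
move=> e0.
have compactK : compact [set p : 'rV[R]_n | `|p| <= N /\ e <= `|p - p0|].
  apply: bounded_closed_compact.
    exists N; split; first exact: num_real.
    by move=> M NM p [pN _] /=; rewrite (le_trans pN)// ltW.
  apply: closedI.
    apply: (@preimage_closed _ _ (fun p : 'rV[R]_n => `|p|) [set r | r <= N]).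
      by move=> p _; exact: norm_continuous.
    exact: closed_le.
  apply: (@preimage_closed _ _ (fun p : 'rV[R]_n => `|p - p0|)
    [set r | e <= r]).
    move=> p _; apply: (cvg_comp (fun p : 'rV[R]_n => p - p0) Num.norm).
      have FF := nbhs_filter p.
      by apply: cvgB; [exact: cvg_id|exact: cvg_cst].
    exact: norm_continuous.
  exact: closed_ge.
have /compact_near_coveringP cover := compactK.
have near_lt := cover _ (nbhs (t0, x0))
  (fun z p => (phi z.1 z.2 p < phi z.1 z.2 p0)%E) _.
near=> z => p pN pz; rewrite ltNge; apply/negP => ep.
have : (phi z.1 z.2 p < phi z.1 z.2 p0)%E; last by rewrite ltNge pz.
suff : [set p : 'rV[R]_n | `|p| <= N /\ e <= `|p - p0|] `<=`
    [set p | (phi z.1 z.2 p < phi z.1 z.2 p0)%E].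
  by apply; split=> //; exact: le_trans (le_norm_enorm _) pN.
near: z; apply: near_lt => q [qN eq]; apply: near_phi_lt => qp0.
by move: eq; rewrite qp0 subrr normr0 leNgt e0.
Unshelve. all: by end_near. Qed.

(** * Values and increments of the Hopf formula *)

Lemma hopf_ell z p s : ell z.1 z.2 p -> fenchel sigma p = s%:E ->
  hopf H sigma z = dot z.2 p - s - G z.1 p.
Proof.
move=> pz ps; rewrite /hopf (@emaxE _ _ (phi z.1 z.2 p)).
- by rewrite (phi_fin _ _ _ _ ps).
- by exists p.
- by move=> _ [q _ <-]; exact: pz.
Qed.

(** An infinite conjugate would give the value [-oo], below the finite value at [p0]. *)
Lemma ell_fin t x p : ell t x p -> exists s, fenchel sigma p = s%:E.
Proof.
move=> ptx; case: (fenchel_cases p) => // poo; have [s p0s] := fenchel_p0.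
have := ptx p0; rewrite -!/(phi _ _ _).
by rewrite (phi_pinfty _ _ _ poo) (phi_fin _ _ _ _ p0s) leeNy_eq.
Qed.

Lemma hopf_increment_le (d e : R) : 0 < d -> 0 < e ->
  \forall z \near (t0, x0), exists2 p, `|p - p0| < d &
    - (e * `|z.1 - t0|)
      <= hopf H sigma z - hopf H sigma (t0, x0)
         - (dot (z.2 - x0) p0 - H (t0, p0) * (z.1 - t0))
      <= dot (z.2 - x0) (p - p0) + e * `|z.1 - t0|.
Proof.
move=> d0 e0; have [s p0s] := fenchel_p0; have [N near_N] := near_ell_attained.
have /nbhs_ballP[r /= r0 incr] :=
  near_action_increment T H H_cont t0 p0 e t0T e0.
(* [d] is the closeness to [p0] asked for; [r] keeps [p] where the increment estimate on [G]
   applies. *)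
have dr0 : 0 < Num.min d r by rewrite lt_min d0.
have near_p := near_ell_close N (Num.min d r) dr0.
near=> z.
have [p pN pz] : exists2 p, enorm p <= N & ell z.1 z.2 p by near: z.
have : `|p - p0| < Num.min d r.
  suff : forall p, enorm p <= N -> ell z.1 z.2 p -> `|p - p0| < Num.min d r.
    by apply.
  by near: z.
rewrite lt_min => /andP[pd pr]; exists p => //.
have tr : `|z.1 - t0| < r.
  near: z; apply: (@near_fst R _ t0 x0 (fun t => `|t - t0| < r)).
  exact: (@near_dist_lt R R^o).
have incrq q : `|q - p0| < r -> `|G z.1 q - G t0 q - H (t0, p0) * (z.1 - t0)|
    <= e * `|z.1 - t0|.
  move=> qr; apply: (incr (z.1, q)).
  by split; rewrite -ball_normE /ball_ /= distrC.
have := incrq p pr; have := incrq p0; rewrite subrr normr0 => /(_ r0).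
have [sp ps] := ell_fin _ _ _ pz.
have ell0 : ell (t0, x0).1 (t0, x0).2 p0 := ell_t0.
rewrite (hopf_ell _ _ _ pz ps) (hopf_ell _ _ _ ell0 p0s) /=.
(* Optimality of [p] at [z] tested on [p0] gives the lower bound, optimality of [p0] at [(t0, x0)]
   tested on [p] the upper one. *)
have := pz p0; have := ell_t0 p; rewrite -!/(phi _ _ _).
rewrite !(phi_fin _ _ _ _ ps) !(phi_fin _ _ _ _ p0s) !lee_fin.
rewrite !ler_norml !dotBl !dotBr; set c := H _ * _; lra.
Unshelve. all: by end_near. Qed.

End maximizers.

Theorem theorem2p3 (R : realType) (n : nat) (T : R)
    (H : R * 'rV[R]_n -> R) (sigma : 'rV[R]_n -> R)
    (T_gt0 : 0 < T)
    (H_cont : {within `[0, T]%classic `*` [set: 'rV[R]_n], continuous H})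
    (sigma_cont : continuous sigma)
    (sigma_convex : convex_function [set: 'rV[R]_n] sigma)
    (hA1 : condA1 T H sigma)
    (t0 : R) (x0 : 'rV[R]_n) (t0_in : 0 < t0 < T)
    (ell_singleton : exists p : 'rV[R]_n, ell H sigma t0 x0 = [set p]) :
  differentiable (hopf H sigma) (t0, x0).
Proof.
have [p0 ell_p0] := ell_singleton.
(* The gradient in [(t, x)] is [(- H (t0, p0), p0)]. *)
pose df (h : R * 'rV[R]_n) : R := dot h.2 p0 - H (t0, p0) * h.1.
have df_linear : linear df.
  by move=> a u v; rewrite /df /= dotDl dotZl /GRing.scale /=; ring.
pose dfM := GRing.isLinear.Build _ _ _ _ _ df_linear.
pose dfL : {linear _ -> _} := HB.pack df dfM.
apply: (near_differentiable _ dfL) => [h|e e0].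
  have FF := nbhs_filter h.
  apply: cvgB; first by apply: cvg_dot; [exact: cvg_snd|exact: cvg_cst].
  by apply: cvgM; [exact: cvg_cst|exact: cvg_fst].
have e20 : 0 < e / 2 by rewrite divr_gt0.
(* This absorbs the factor [n] of [norm_dot_le]; the successor keeps the divisor nonzero when
   [n = 0]. *)
have d0 : 0 < e / 2 / n.+1%:R by rewrite divr_gt0.
have near_u := hopf_increment_le T H sigma H_cont hA1 t0 x0 p0 t0_in ell_p0
  _ _ d0 e20.
near=> z.
have [p pd] : exists2 p, `|p - p0| < e / 2 / n.+1%:R &
    - (e / 2 * `|z.1 - t0|)
      <= hopf H sigma z - hopf H sigma (t0, x0)
         - (dot (z.2 - x0) p0 - H (t0, p0) * (z.1 - t0))
      <= dot (z.2 - x0) (p - p0) + e / 2 * `|z.1 - t0| by near: z.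
rewrite -/(df (z - (t0, x0))).
have t_le : e / 2 * `|z.1 - t0| <= e / 2 * `|z - (t0, x0)|.
  by rewrite ler_pM2l// prod_normE le_max lexx.
have x_le : `|z.2 - x0| <= `|z - (t0, x0)|.
  by rewrite prod_normE le_max lexx orbT.
have dot_le : dot (z.2 - x0) (p - p0) <= e / 2 * `|z - (t0, x0)|.
  rewrite (le_trans (ler_norm _))// (le_trans (norm_dot_le _ _))//.
  rewrite mulrCA mulrC ler_pM// ?mulr_ge0//.
  move: pd; rewrite ltr_pdivlMr// => /ltW; apply: le_trans.
  by rewrite mulrC ler_wpM2l// ler_nat.
have m_ge0 : 0 <= e / 2 * `|z - (t0, x0)| by rewrite mulr_ge0// ltW.
change (dfL (z - (t0, x0))) with (df (z - (t0, x0))).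
move: (df _) (`|z - _|) t_le dot_le m_ge0 {x_le pd} => l m t_le dot_le m_ge0.
rewrite ler_norml; lra.
Unshelve. all: by end_near. Qed.
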